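(* Let $n\ge 0$ be a natural number, $\mathcal{A}=\{1,\dots,n\}$, and $\mathcal{D}_n$ the lattice of antichains over $\mathcal{A}$. Then $$D(n+4)=\sum P_4(\alpha,\beta_{12},\beta_{13},\beta_{14},\beta_{23},\beta_{24},\beta_{34})\cdot P_4(\widetilde{\epsilon},\widetilde{\delta_{12}},\widetilde{\delta_{13}},\widetilde{\delta_{14}},\widetilde{\delta_{23}},\widetilde{\delta_{24}},\widetilde{\delta_{34}})\cdot|[\bot,\alpha]|\cdot|[\beta_{12},\delta_{12}]|\cdot|[\beta_{13},\delta_{13}]|\cdot|[\beta_{14},\delta_{14}]|\cdot|[\beta_{23},\delta_{23}]|\cdot|[\beta_{24},\delta_{24}]|\cdot|[\beta_{34},\delta_{34}]|\cdot|[\epsilon,\top]| ,$$ where the sum runs over all $\alpha,\epsilon\in\mathcal{D}_n$ and all $\beta_{ij},\delta_{ij}\in\mathcal{D}_n$ ($1\le i<j\le 4$) such that $$\alpha\le\beta_{12}\wedge\beta_{13}\wedge\beta_{14}\wedge\beta_{23}\wedge\beta_{24}\wedge\beta_{34},\qquad \epsilon\ge\delta_{12}\vee\delta_{13}\vee\delta_{14}\vee\delta_{23}\vee\delta_{24}\vee\delta_{34},\qquad \beta_{ij}\le\delta_{ij}\ (1\le i<j\le 4).$$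
   Context: For $n\ge 0$ let $\mathcal{A}=\{1,\dots,n\}$. An antichain over $\mathcal{A}$ is a set of pairwise non-inclusive subsets of $\mathcal{A}$ (the empty set of subsets $\{\}$ and the singleton $\{\emptyset\}$ are both antichains). $\mathcal{D}_n$ is the set of all antichains over $\mathcal{A}$, and $D(n)=|\mathcal{D}_n|$ is the $n$-th Dedekind number. $\mathcal{D}_n$ is partially ordered by: $\alpha\le\beta$ iff for every $X\in\alpha$ there is $Y\in\beta$ with $X\subseteq Y$. Its smallest and largest elements are $\bot=\{\}$ and $\top=\{\{1,\dots,n\}\}$. For a set $S$ of subsets of $\mathcal{A}$, $\max(S)$ is the set of inclusion-maximal members of $S$. Join and meet are $\alpha\vee\beta=\max(\alpha\cup\beta)$ and $\alpha\wedge\beta=\max(\{X\cap Y: X\in\alpha, Y\in\beta\})$. The interval is $[\alpha,\beta]=\{\chi\in\mathcal{D}_n:\alpha\le\chi\le\beta\}$. The dual of $\alpha\in\mathcal{D}_n$ is $\widetilde{\alpha}=\max(\{X\subseteq\mathcal{A}: \{\mathcal{A}\setminus X\}\not\le\alpha\})$. The coefficient $P_4$. Let $a$ and $b_{ij}=b_{ji}$ ($1\le i<j\le 4$) be antichains in $\mathcal{D}_n$ with $a\le b_{ij}$. The number of solutions $(\chi_1,\chi_2,\chi_3,\chi_4)\in\mathcal{D}_n^4$ of the system $$\chi_1\wedge\chi_2\wedge\chi_3\wedge\chi_4=a,\qquad \chi_i\vee\chi_j=b_{ij}\quad(1\le i<j\le 4)$$ is given by $$P_4(a,b_{12},b_{13},b_{14},b_{23},b_{24},b_{34})=\prod_{c\in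 C_{a,\gamma}}w(c),$$ with the following notation. $\gamma=\bigl(\bigcup_{i<j}b_{ij}\bigr)-a$ (set difference). Two sets $X,Y\in\gamma$ are directly connected with respect to $a$ if $\{X\cap Y\}\not\le a$, and connected with respect to $a$ if they are directly connected or joined by a finite sequence of sets in $\gamma$ in which consecutive sets are directly connected. $C_{a,\gamma}$ is the set of connected components of the graph with vertex set $\gamma$ and an edge between two sets iff they are connected with respect to $a$. A set $X\in\gamma$ is dominating in $\gamma$ if no $Y\in\gamma$ satisfies $X\subsetneq Y$. If the system has at least one solution, then for $X$ dominating in $\gamma$ with $X\notin b_{kl}$ for at least one pair $k\ne l$, $S_X\subseteq\{1,2,3,4\}$ is the non-empty set such that $s\in S_X$ iff $X\in b_{si}$ for all $i\in\{1,2,3,4\}-\{s\}$. A set $X$ is dominated by an antichain $\delta$ if $\{X\}\le\delta$. The weight $w(c)$ of a component $c$ is defined as follows: if $c$ does not contain a set occurring in all $b_{ij}$, then $w(c)=0$ if $\bigcup_{X\in c}S_X=\{1,2,3,4\}$ and $w(c)=1$ otherwise; if $c$ contains at least one set dominated by all $b_{ij}$, then $w(c)=4-\bigl|\bigcup_{X\in c}S_X\bigr|$. The unions are over those $X\in c$ for which $S_X$ is defined.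
   Formalization: P_4 is taken as the number of solutions of the system (the product of weights is not always that number), and the second P_4 lists the duals by complementary pairs, as δ34, δ24, δ23, δ14, δ13, δ12, since the printed order gives 164 instead of D(4)=168 at n=0. *)

(* Defs.v *)
From HB Require Import structures.
From mathcomp Require Import all_boot all_order.
Set Implicit Arguments.
Unset Strict Implicit.
Unset Printing Implicit Defensive.
Import Order.TTheory.

(* The ground set {1, ..., n} is represented by 'I_n. *)

Definition is_antichain n (A : {set {set 'I_n}}) : bool :=
  [forall X in A, forall Y in A, (X \subset Y) ==> (X == Y)].

Record antichain n := Antichain {
  members :> {set {set 'I_n}};
  membersP : is_antichain members
}.

HB.instance Definition _ n := [isSub for @members n].
HB.instance Definition _ n := [Finite of antichain n by <:].

Definition dedekind n : nat := #|{: antichain n}|.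

Definition dominated n (S T : {set {set 'I_n}}) : bool :=
  [forall X in S, exists Y in T, X \subset Y].

Definition maximals n (S : {set {set 'I_n}}) : {set {set 'I_n}} :=
  [set X | maxset [in S] X].

Lemma maximals_is_antichain n (S : {set {set 'I_n}}) :
  is_antichain (maximals S).
Proof.
apply/'forall_implyP => X; rewrite inE => /maxsetP[_ maxX].
apply/'forall_implyP => Y; rewrite inE => /maxsetP[SY _].
by apply/implyP => sXY; rewrite (maxX _ SY sXY).
Qed.

Definition max_antichain n (S : {set {set 'I_n}}) : antichain n :=
  Antichain (maximals_is_antichain S).

Section Order.

Variable n : nat.
Implicit Types (S T : {set {set 'I_n}}) (a b c : antichain n).

Definition antichain_le a b : bool := dominated a b.
Definition antichain_join a b : antichain n := max_antichain (a :|: b).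
Definition antichain_meet a b : antichain n :=
  max_antichain [set X :&: Y | X in (a : {set _}), Y in (b : {set _})].

Lemma dominatedP S T :
  reflect (forall X, X \in S -> exists2 Y, Y \in T & X \subset Y)
          (dominated S T).
Proof.
apply: (iffP 'forall_implyP) => leST X /leST.
  by case/exists_inP=> Y TY sXY; exists Y.
by case=> Y TY sXY; apply/exists_inP; exists Y.
Qed.

Lemma dominated_maxl S T : dominated (maximals S) T = dominated S T.
Proof.
apply/dominatedP/dominatedP => leST X.
  move=> SX; have [Z maxZ sXZ] := @maxset_exists _ [in S] X SX.
  have [|Y TY sZY] := leST Z; first by rewrite inE.
  by exists Y => //; apply: subset_trans sZY.
by rewrite inE => /maxsetp/leST.
Qed.

Lemma dominated_maxr S T : dominated S (maximals T) = dominated S T.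
Proof.
apply/dominatedP/dominatedP => leST X /leST[Y].
  by rewrite inE => /maxsetp TY sXY; exists Y.
move=> TY sXY; have [Z maxZ sYZ] := @maxset_exists _ [in T] Y TY.
by exists Z; [rewrite inE | apply: subset_trans sYZ].
Qed.

Fact antichain_le_refl : reflexive antichain_le.
Proof. by move=> a; apply/dominatedP => X aX; exists X. Qed.

Fact antichain_le_trans : transitive antichain_le.
Proof.
move=> b a c /dominatedP leab /dominatedP lebc; apply/dominatedP => X /leab.
case=> Y /lebc[Z cZ sYZ] sXY; exists Z => //; exact: subset_trans sYZ.
Qed.

Fact antichain_le_anti : antisymmetric antichain_le.
Proof.
have half a b : antichain_le a b -> antichain_le b a -> {subset a <= b}.
  move=> /dominatedP leab /dominatedP leba X aX.
  have [Y bY sXY] := leab X aX; have [Z aZ sYZ] := leba Y bY.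
  have /'forall_implyP/(_ X aX)/'forall_implyP/(_ Z aZ) := membersP a.
  rewrite (subset_trans sXY sYZ) => /eqP eqXZ.
  by have -> : X = Y by apply/eqP; rewrite eqEsubset sXY eqXZ.
move=> a b /andP[leab leba]; apply/val_inj/setP => X.
by apply/idP/idP; apply: half.
Qed.

Fact antichain_meetP c a b :
  antichain_le c (antichain_meet a b) = antichain_le c a && antichain_le c b.
Proof.
rewrite /antichain_le dominated_maxr.
apply/dominatedP/andP => [lec | [/dominatedP leca /dominatedP lecb] X cX].
  split; apply/dominatedP=> X /lec[_ /imset2P[Y Z aY bZ ->]];
  rewrite subsetI => /andP[sXY sXZ]; [by exists Y | by exists Z].
have [Y aY sXY] := leca X cX; have [Z bZ sXZ] := lecb X cX.
by exists (Y :&: Z); rewrite ?subsetI ?sXY //; apply/imset2P; exists Y Z.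
Qed.

Fact antichain_joinP a b c :
  antichain_le (antichain_join a b) c = antichain_le a c && antichain_le b c.
Proof.
rewrite /antichain_le dominated_maxl.
apply/dominatedP/andP => [lec | [/dominatedP leac /dominatedP lebc] X].
  by split; apply/dominatedP => X SX; apply: lec; rewrite inE SX ?orbT.
by rewrite inE => /orP[/leac | /lebc].
Qed.

Fact bot_is_antichain : is_antichain (set0 : {set {set 'I_n}}).
Proof. by apply/'forall_implyP => X; rewrite inE. Qed.

Fact top_is_antichain : is_antichain [set [set: 'I_n]].
Proof.
apply/'forall_implyP => X /set1P->; apply/'forall_implyP => Y /set1P->.
by rewrite eqxx implybT.
Qed.

Definition antichain_bot : antichain n := Antichain bot_is_antichain.
Definition antichain_top : antichain n := Antichain top_is_antichain.

Fact antichain_le0x a : antichain_le antichain_bot a.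
Proof. by apply/dominatedP => X; rewrite inE. Qed.

Fact antichain_lex1 a : antichain_le a antichain_top.
Proof. by apply/dominatedP => X _; exists setT; rewrite ?set11 ?subsetT. Qed.

End Order.

Fact antichain_display : Order.disp_t. Proof. exact: Order.Disp tt tt. Qed.

HB.instance Definition _ n :=
  @Order.Le_isPOrder.Build antichain_display (antichain n) (@antichain_le n)
    (@antichain_le_refl n) (@antichain_le_anti n) (@antichain_le_trans n).
HB.instance Definition _ n :=
  @Order.POrder_MeetJoin_isLattice.Build antichain_display (antichain n)
    (@antichain_meet n) (@antichain_join n)
    (fun a b c => antichain_meetP a b c) (@antichain_joinP n).
HB.instance Definition _ n :=
  @Order.hasBottom.Build antichain_display (antichain n) (antichain_bot n)
    (@antichain_le0x n).
HB.instance Definition _ n :=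
  @Order.hasTop.Build antichain_display (antichain n) (antichain_top n)
    (@antichain_lex1 n).

Lemma antichain_leE n (a b : antichain n) :
  (a <= b)%O = [forall X in a : {set _}, exists Y in b : {set _}, X \subset Y].
Proof. by []. Qed.

Lemma antichain_joinE n (a b : antichain n) :
  members (a `|` b)%O = maximals (a :|: b).
Proof. by []. Qed.

Lemma antichain_meetE n (a b : antichain n) :
  members (a `&` b)%O =
  maximals [set X :&: Y | X in (a : {set _}), Y in (b : {set _})].
Proof. by []. Qed.

Lemma antichain_botE n : members (\bot%O : antichain n) = set0.
Proof. by []. Qed.

Lemma antichain_topE n : members (\top%O : antichain n) = [set [set: 'I_n]].
Proof. by []. Qed.

Definition interval n (a b : antichain n) : {set antichain n} :=
  [set x | (a <= x <= b)%O].

Definition dual n (a : antichain n) : antichain n :=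
  max_antichain [set X | ~~ dominated [set ~: X] a].

(* P4 is the number of solutions of the system.  It is not the product of
   component weights over the connected components of
   (\bigcup_(i < j) b_ij) :\: a that has been proposed as a closed form.  For
   n = 2, a = {{}}, b12 = b13 = b14 = {{1,2}} and b23 = b24 = b34 = {{1},{2}},
   that set has a single component, of weight at most 3, but the system has 9
   solutions: x1 = {{1,2}} and any x2, x3, x4 such that each of 1 and 2 is
   missing from exactly one of them. *)
Definition P4 n (a b12 b13 b14 b23 b24 b34 : antichain n) : nat :=
  #|[set x : antichain n * antichain n * antichain n * antichain n |
      let: (x1, x2, x3, x4) := x in
      [&& x1 `&` x2 `&` x3 `&` x4 == a,
          x1 `|` x2 == b12, x1 `|` x3 == b13, x1 `|` x4 == b14,
          x2 `|` x3 == b23, x2 `|` x4 == b24 & x3 `|` x4 == b34]%O]|.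

(* Main.v *)
Require Import Defs.
From mathcomp Require Import all_boot all_order.
Import Order.TTheory.

Set Implicit Arguments.
Unset Strict Implicit.
Unset Printing Implicit Defensive.

(** An antichain is determined by the down-set of all subsets of its members.  In
    terms of down-sets the order is inclusion, meet and join are intersection
    and union, and the dual keeps the sets whose complement is not in the
    down-set ([covers_le], [covers_meet], [covers_join], [covers_dual]).  Cutting a down-set of subsets
    of [{0, ..., n}] along the element [0] gives two nested down-sets one
    dimension lower, and every nested pair arises once.  Doing this four times
    identifies the antichains over [n + 4] points with the order-reversing maps
    [f] from the subsets of [{1,2,3,4}] to the antichains over [n] points
    ([dedekind_cube]).

    Fix the values [x_i = f ({1,2,3,4} \ i)] on the triples and [y_i = f {i}] on
    the singletons.  Each of the eight other values is then constrained only by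
    these, hence varies in an interval independently of the other seven:
    - [f {1,2,3,4}] lies below the meet of the [x_i];
    - [f] at the complement [{k, l}] of [{i, j}] lies between [x_i `|` x_j] and
      [y_k `&` y_l];
    - [f {}] lies above the join of the [y_i].
    So [dedekind (n + 4)] is a sum over [x] and [y] of a product of eight
    interval sizes ([monotone_cubes]), and this product depends on [x] and [y]
    only through the meet and pairwise joins of [x] and the join and pairwise
    meets of [y].  Grouping the quadruples by these values makes the sizes of
    the fibres appear: for [x] the fibre size is [P4] by definition, and for [y]
    it is [P4] at the dual arguments because the dual is an order-reversing
    involution ([P4_upper_profile]).  Finally, the side conditions of the sum
    only discard terms in which a fibre or an interval is empty
    ([profile_bounds], [interval_nonempty]). *)

(** * Antichains as down-sets *)

Fact covers_key : unit. Proof. by []. Qed.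

(** Sealed so that a comparison of two antichains never unfolds this finite
    quantification over their members. *)
Definition covers n (a : antichain n) (X : {set 'I_n}) : bool :=
  locked_with covers_key [exists Y in members a, X \subset Y].

Lemma coversP n (a : antichain n) (X : {set 'I_n}) :
  reflect (exists2 Y, Y \in members a & X \subset Y) (covers a X).
Proof. by rewrite [covers a X]unlock; apply: exists_inP. Qed.

Lemma dominated1 n (X : {set 'I_n}) (a : antichain n) :
  dominated [set X] a = covers a X.
Proof.
apply/dominatedP/coversP => [/(_ X (set11 X)) //| [Y aY sXY] Z /set1P->].
by exists Y.
Qed.

Lemma covers_le n (a b : antichain n) :
  reflect (forall X, covers a X -> covers b X) (a <= b)%O.
Proof.
apply: (iffP (dominatedP _ _)) => [leab X | sab X aX].
  case/coversP=> Y /leab[Z bZ sYZ] sXY; apply/coversP; exists Z => //.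
  exact: subset_trans sYZ.
by apply/coversP/sab/coversP; exists X.
Qed.

Lemma covers_inj n (a b : antichain n) : covers a =1 covers b -> a = b.
Proof.
by move=> eqab; apply: le_anti; apply/andP;
   split; apply/covers_le => X; rewrite eqab.
Qed.

Lemma coversS n (a : antichain n) (X Y : {set 'I_n}) :
  X \subset Y -> covers a Y -> covers a X.
Proof.
move=> sXY /coversP[Z aZ sYZ]; apply/coversP; exists Z => //.
exact: subset_trans sYZ.
Qed.

(** Passing to the maximal members loses nothing, since in a finite poset every
    member lies below a maximal one. *)
Lemma covers_max n (S : {set {set 'I_n}}) X :
  covers (max_antichain S) X = [exists Y in S, X \subset Y].
Proof.
rewrite -dominated1 dominated_maxr; apply/dominatedP/exists_inP.
  by apply; rewrite set11.
by case=> Y SY sXY Z /set1P->; exists Y.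
Qed.

Lemma covers_max_closed n (S : pred {set 'I_n}) X :
    (forall Y Z : {set 'I_n}, Y \subset Z -> S Z -> S Y) ->
  covers (max_antichain [set Y | S Y]) X = S X.
Proof.
move=> closedS; rewrite covers_max; apply/exists_inP/idP => [[Y] | SX].
  by rewrite inE => SY sXY; apply: closedS SY.
by exists X; rewrite ?inE.
Qed.

Lemma covers_meet n (a b : antichain n) X :
  covers (a `&` b)%O X = covers a X && covers b X.
Proof.
rewrite [LHS]covers_max; apply/exists_inP/andP.
  case=> _ /imset2P[Y Z aY bZ ->]; rewrite subsetI => /andP[sXY sXZ].
  by split; apply/coversP; [exists Y | exists Z].
case=> /coversP[Y aY sXY] /coversP[Z bZ sXZ].
by exists (Y :&: Z); rewrite ?subsetI ?sXY ?imset2_f.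
Qed.

Lemma covers_join n (a b : antichain n) X :
  covers (a `|` b)%O X = covers a X || covers b X.
Proof.
rewrite [LHS]covers_max; apply/exists_inP/orP.
  by case=> Y /setUP[aY | bY] sXY; [left | right]; apply/coversP; exists Y.
by case=> /coversP[Y SY sXY]; exists Y; rewrite // inE SY ?orbT.
Qed.

(** The sets whose complement is not covered form a down-set, because
    complementation reverses inclusion; the dual is the antichain of its
    maximal members. *)
Lemma covers_dual n (a : antichain n) X :
  covers (dual a) X = ~~ covers a (~: X).
Proof.
rewrite [LHS]covers_max_closed ?dominated1 // => Y Z sYZ.
by rewrite 2!dominated1; apply: contra; apply: coversS; rewrite setCS.
Qed.

Lemma dualK n : involutive (@dual n).
Proof.
by move=> a; apply: covers_inj => X; rewrite 2!covers_dual setCK negbK.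
Qed.

Lemma dual_meet n (a b : antichain n) :
  dual (a `&` b)%O = (dual a `|` dual b)%O.
Proof.
apply: covers_inj => X.
by rewrite covers_dual covers_meet covers_join 2!covers_dual negb_and.
Qed.

Lemma dual_join n (a b : antichain n) :
  dual (a `|` b)%O = (dual a `&` dual b)%O.
Proof.
apply: covers_inj => X.
by rewrite covers_dual covers_meet covers_join 2!covers_dual negb_or.
Qed.

(** * Cutting along one element *)

Definition extend n (b : bool) (X : {set 'I_n}) : {set 'I_n.+1} :=
  [set i | if unlift ord0 i is Some j then j \in X else b].

Lemma extend_subset n b c (X Y : {set 'I_n}) :
  (extend b X \subset extend c Y) = (b ==> c) && (X \subset Y).
Proof.
apply/subsetP/andP => [sXY | [/implyP leb /subsetP sXY] i].
  split; first by have := sXY ord0; rewrite !inE unlift_none => /implyP.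
  by apply/subsetP=> j; have := sXY (lift ord0 j); rewrite !inE liftK.
by rewrite !inE; case: unliftP => [j _ | _]; [apply: sXY | apply: leb].
Qed.

Lemma extendP n (Z : {set 'I_n.+1}) : exists b, exists X, Z = extend b X.
Proof.
exists (ord0 \in Z), [set j | lift ord0 j \in Z]; apply/setP=> i.
by rewrite inE; case: unliftP => [j ->|->]; rewrite ?inE.
Qed.

(** The sections of the down-set of [a] at the element [0]: the sets that stay
    covered after [0] has been added ([b = true]), and the covered sets avoiding
    [0] ([b = false]). *)
Definition slice n (b : bool) (a : antichain n.+1) : antichain n :=
  max_antichain [set X | covers a (extend b X)].

Lemma covers_slice n b (a : antichain n.+1) X :
  covers (slice b a) X = covers a (extend b X).
Proof.
rewrite [LHS]covers_max_closed // => Y Z sYZ.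
by apply: coversS; rewrite extend_subset implybb.
Qed.

Lemma slice_le n (a b : antichain n.+1) :
  (a <= b)%O =
  (slice true a <= slice true b)%O && (slice false a <= slice false b)%O.
Proof.
apply/covers_le/andP => [sab | [/covers_le st /covers_le sf] Z].
  by split; apply/covers_le => X; rewrite 2!covers_slice; apply: sab.
by have [[] [X ->]] := extendP Z; rewrite -2!covers_slice;
   [apply: st | apply: sf].
Qed.

Lemma slice_true_false n (a : antichain n.+1) :
  (slice true a <= slice false a)%O.
Proof.
apply/covers_le => X; rewrite 2!covers_slice.
by apply: coversS; rewrite extend_subset /=.
Qed.

(** The two sections [x] and [y] are glued by extending the sets of [x] by [0]
    and those of [y] by nothing.  The hypothesis [x <= y] is what makes the
    result a down-set: removing [0] from a set extended from [x] must land
    in [y]. *)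
Lemma slice_onto n (x y : antichain n) : (x <= y)%O ->
  exists2 a : antichain n.+1, slice true a = x & slice false a = y.
Proof.
move=> /covers_le sxy.
pose S := [set extend b X | b in {: bool},
                            X in [set X | covers (if b then x else y) X]].
have covS b X : covers (max_antichain S) (extend b X) =
                covers (if b then x else y) X.
  rewrite covers_max; apply/exists_inP/idP => [[_ /imset2P[c Y _ + ->]] | bX].
    rewrite inE extend_subset => cY /andP[bc sXY]; apply: coversS sXY _.
    by case: b c bc cY => [] [] // _ /sxy.
  by exists (extend b X); rewrite // imset2_f ?inE.
exists (max_antichain S); apply: covers_inj => X;
  by rewrite covers_slice covS.
Qed.

(** * Iterated cuts *)

(** A map from the subsets of a [k]-element set to [T], as nested pairs: at each
    level the first component gathers the subsets that contain the element cut
    at that level. *)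
Fixpoint cube (T : finType) k : finType :=
  if k is k'.+1 then (cube T k' * cube T k')%type else T.

Fixpoint cube_le n k {struct k} : rel (cube (antichain n) k) :=
  if k is k'.+1 then fun s t => cube_le s.1 t.1 && cube_le s.2 t.2
  else fun s t => (s <= t)%O.

(** The first component of each pair belongs to the larger subsets, so these are
    the maps that reverse inclusion. *)
Fixpoint cube_mono n k {struct k} : pred (cube (antichain n) k) :=
  if k is k'.+1 then
    fun t => [&& cube_mono t.1, cube_mono t.2 & cube_le t.1 t.2]
  else xpredT.

Fixpoint slices n k {struct k} : antichain (k + n) -> cube (antichain n) k :=
  if k is k'.+1 then
    fun a => (slices (slice true a), slices (slice false a))
  else id.

Lemma slices_le n k (a b : antichain (k + n)) :
  (a <= b)%O = cube_le (slices a) (slices b).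
Proof. by elim: k a b => //= k IHk a b; rewrite slice_le !IHk. Qed.

Lemma slices_inj n k : injective (@slices n k).
Proof.
by move=> a b eqab; apply: le_anti; rewrite !slices_le eqab -slices_le lexx.
Qed.

Lemma slices_mono n k (a : antichain (k + n)) : cube_mono (slices a).
Proof.
by elim: k a => //= k IHk a; rewrite !IHk -slices_le slice_true_false.
Qed.

Lemma slices_onto n k (t : cube (antichain n) k) :
  cube_mono t -> exists a : antichain (k + n), slices a = t.
Proof.
elim: k t => [|k IHk] /=; first by move=> t _; exists t.
case=> s t /= /and3P[/IHk[x <-] /IHk[y <-]].
by rewrite -slices_le => /slice_onto[a <- <-]; exists a.
Qed.

(** [slices] is an order embedding, hence injective, and its image consists of
    the inclusion-reversing maps. *)
Lemma dedekind_cube n k :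
  dedekind (k + n) = #|[set t : cube (antichain n) k | cube_mono t]|.
Proof.
rewrite /dedekind -cardsT -(card_imset _ (@slices_inj n k)).
congr #|pred_of_set _|.
apply/setP => t; rewrite inE.
apply/imsetP/idP => [[a _ ->] | /slices_onto[a <-]].
  exact: slices_mono.
by exists a.
Qed.

(** * The data through which triples and singletons enter the sum *)

Local Notation quad T := (T * T * T * T)%type.
Local Notation septet T := (T * T * T * T * T * T * T)%type.

Definition lower_profile n (x : quad (antichain n)) : septet (antichain n) :=
  let: (x1, x2, x3, x4) := x in
  (x1 `&` x2 `&` x3 `&` x4, x1 `|` x2, x1 `|` x3, x1 `|` x4,
   x2 `|` x3, x2 `|` x4, x3 `|` x4)%O.

(** The meets are listed by complementary pairs: the entry at the place of
    [{i, j}] bounds from above the value at the complement of [{i, j}], hence is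
    the meet of the [y_k] for [k] in that complement. *)
Definition upper_profile n (y : quad (antichain n)) : septet (antichain n) :=
  let: (y1, y2, y3, y4) := y in
  (y1 `|` y2 `|` y3 `|` y4, y3 `&` y4, y2 `&` y4, y2 `&` y3,
   y1 `&` y4, y1 `&` y3, y1 `&` y2)%O.

Lemma P4_lower_profile n (a b12 b13 b14 b23 b24 b34 : antichain n) :
  P4 a b12 b13 b14 b23 b24 b34 =
  #|[set x | lower_profile x == (a, b12, b13, b14, b23, b24, b34)]|.
Proof.
apply: eq_card => -[[[x1 x2] x3] x4]; rewrite !inE /= !xpair_eqE.
by rewrite -!andbA.
Qed.

(** Dualizing the four unknowns exchanges meets and joins, which turns the
    system that defines [P4] at the dual arguments into the one for the joins
    and meets of [y]. *)
Lemma P4_upper_profile n (e d12 d13 d14 d23 d24 d34 : antichain n) :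
  P4 (dual e) (dual d34) (dual d24) (dual d23) (dual d14) (dual d13) (dual d12) =
  #|[set y | upper_profile y == (e, d12, d13, d14, d23, d24, d34)]|.
Proof.
pose dual4 (y : quad (antichain n)) : quad (antichain n) :=
  let: (y1, y2, y3, y4) := y in (dual y1, dual y2, dual y3, dual y4).
have dual4K : involutive dual4.
  by move=> [[[y1 y2] y3] y4]; rewrite /dual4 !dualK.
have dual_eq : forall a b : antichain n, (dual a == dual b) = (a == b).
  by move=> a b; apply: inj_eq; apply: inv_inj (@dualK n).
rewrite P4_lower_profile -[RHS](card_imset _ (inv_inj dual4K)).
apply: eq_card => y; rewrite -[y]dual4K (mem_imset _ _ (inv_inj dual4K)) 2!inE.
move: (dual4 y) => {y} [[[y1 y2] y3] y4] /=.
rewrite !xpair_eqE -3!dual_join -6!dual_meet.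
rewrite (dual_eq _ e) (dual_eq _ d12) (dual_eq _ d13) (dual_eq _ d14).
rewrite (dual_eq _ d23) (dual_eq _ d24) (dual_eq _ d34).
(* Both sides list the same seven equations in a different order. *)
by do !case: (_ == _).
Qed.

(** * The sum over triples and singletons *)

(** The number of ways to choose the values at the full set, at the six pairs
    and at the empty set once the bounds [s] and [t] are known. *)
Definition fillings n (s t : septet (antichain n)) : nat :=
  let: (a, b12, b13, b14, b23, b24, b34) := s in
  let: (e, d12, d13, d14, d23, d24, d34) := t in
  #|interval \bot%O a|
  * #|interval b12 d12| * #|interval b13 d13| * #|interval b14 d14|
  * #|interval b23 d23| * #|interval b24 d24| * #|interval b34 d34|
  * #|interval e \top%O|.

(** Every covering pair of subsets of [{1,2,3,4}] has exactly one of its two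
    members of odd size.  Once the values at the triples and the singletons are
    fixed, the other eight values are therefore bounded by these alone, and
    vary independently, each in an interval. *)
Lemma monotone_cubes n :
  #|[set t : cube (antichain n) 4 | cube_mono t]| =
  \sum_(x : quad (antichain n)) \sum_(y : quad (antichain n))
     fillings (lower_profile x) (upper_profile y).
Proof.
pose A := antichain n.
pose rest := (A * A * A * A * A * A * A * A)%type.
(* The entry pij is the value at the complement of {i, j}. *)
pose cubeOf (p : (quad A * quad A) * rest) : cube A 4 :=
  let: ((x1, x2, x3, x4), (y1, y2, y3, y4),
        (b, p12, p13, p14, p23, p24, p34, t)) := p in
  ((((b, x4), (x3, p34)), ((x2, p24), (p23, y1))),
   (((x1, p14), (p13, y2)), ((p12, y3), (y4, t)))).
pose ofCube (c : cube A 4) : (quad A * quad A) * rest :=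
  let: ((((b, x4), (x3, p34)), ((x2, p24), (p23, y1))),
        (((x1, p14), (p13, y2)), ((p12, y3), (y4, t)))) := c in
  ((x1, x2, x3, x4), (y1, y2, y3, y4), (b, p12, p13, p14, p23, p24, p34, t)).
have ofCubeK : cancel ofCube cubeOf.
  by case=> [[[[? ?] [? ?]] [[? ?] [? ?]]] [[[? ?] [? ?]] [[? ?] [? ?]]]].
have cubeOfK : cancel cubeOf ofCube.
  by case=> [[[[[? ?] ?] ?] [[[? ?] ?] ?]] [[[[[[[? ?] ?] ?] ?] ?] ?] ?]].
have fillingsE (p : quad A * quad A) :
    fillings (lower_profile p.1) (upper_profile p.2) =
    \sum_(r | cube_mono (cubeOf (p, r))) 1.
  case: p => [[[[x1 x2] x3] x4] [[[y1 y2] y3] y4]].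
  rewrite /fillings /lower_profile /upper_profile /= -7!cardsX -sum1_card.
  apply: eq_bigl => -[[[[[[[b p12] p13] p14] p23] p24] p34] t].
  rewrite /= !inE /= !lexI !leUx le0x lex1.
  (* Both sides are the conjunction of the 32 covering relations of the cube. *)
  by do !(case: (_ <= _)%O; rewrite /= ?andbT ?andbF //).
rewrite pair_bigA /= (eq_bigr _ (fun p _ => fillingsE p)) pair_big_dep /=.
rewrite -sum1_card (reindex cubeOf) /=; last by exists ofCube => ? _.
by apply: eq_bigl => -[p r]; rewrite inE.
Qed.

(** * Grouping by profiles *)

Lemma sum_fibres (X Y : finType) (f : X -> Y) (F : Y -> nat) :
  \sum_y #|[set x | f x == y]| * F y = \sum_x F (f x).
Proof.
rewrite [RHS](partition_big f xpredT) //=; apply: eq_bigr => y _.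
rewrite (eq_bigr (fun _ => F y)) => [|x /eqP-> //].
by rewrite sum_nat_const; congr (_ * _); apply: eq_card => x; rewrite inE.
Qed.

Lemma interval_nonempty n (a b : antichain n) :
  #|interval a b| != 0 -> (a <= b)%O.
Proof.
by rewrite cards_eq0 => /set0Pn[x]; rewrite inE => /andP[]; apply: le_trans.
Qed.

Lemma fibre_nonempty (X Y : finType) (f : X -> Y) (y : Y) :
  #|[set x | f x == y]| != 0 -> exists x, f x = y.
Proof. by rewrite cards_eq0 => /set0Pn[x]; rewrite inE => /eqP; exists x. Qed.

Lemma sum_septets (T : finType) (F : septet T -> septet T -> nat) :
  \sum_a \sum_e \sum_b12 \sum_b13 \sum_b14 \sum_b23 \sum_b24 \sum_b34
    \sum_d12 \sum_d13 \sum_d14 \sum_d23 \sum_d24 \sum_d34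
    F (a, b12, b13, b14, b23, b24, b34) (e, d12, d13, d14, d23, d24, d34) =
  \sum_s \sum_t F s t.
Proof.
do 13 rewrite pair_bigA /=; rewrite [RHS]pair_bigA /=.
pose T14 := (T * T * T * T * T * T * T * T * T * T * T * T * T * T)%type.
pose h (p : T14) : septet T * septet T :=
  let: (a, e, b12, b13, b14, b23, b24, b34,
        d12, d13, d14, d23, d24, d34) := p in
  ((a, b12, b13, b14, b23, b24, b34), (e, d12, d13, d14, d23, d24, d34)).
pose k (q : septet T * septet T) : T14 :=
  let: ((a, b12, b13, b14, b23, b24, b34),
        (e, d12, d13, d14, d23, d24, d34)) := q in
  (a, e, b12, b13, b14, b23, b24, b34, d12, d13, d14, d23, d24, d34).
rewrite [RHS](reindex h) /=; last first.
  exists k => [p _ | q _].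
    by case: p => [[[[[[[[[[[[[? ?] ?] ?] ?] ?] ?] ?] ?] ?] ?] ?] ?] ?].
  by case: q => [[[[[[[? ?] ?] ?] ?] ?] ?] [[[[[[? ?] ?] ?] ?] ?] ?]].
by apply: eq_bigr => -[[[[[[[[[[[[[? ?] ?] ?] ?] ?] ?] ?] ?] ?] ?] ?] ?] ?] _.
Qed.

(** Quadruples with the same profile contribute equally, so the sum may run over
    the profiles, weighted by the sizes of their fibres. *)
Lemma sum_profiles n :
  \sum_(x : quad (antichain n)) \sum_(y : quad (antichain n))
     fillings (lower_profile x) (upper_profile y) =
  \sum_s \sum_t #|[set x | @lower_profile n x == s]|
                * (#|[set y | @upper_profile n y == t]| * fillings s t).
Proof.
rewrite -(sum_fibres (@lower_profile n)
           (fun s => \sum_y fillings s (upper_profile y))).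
apply: eq_bigr => s _.
rewrite -(sum_fibres (@upper_profile n) (fillings s)).
exact: (@big_distrr _ _ muln addn).
Qed.

(** These two side conditions hold at every pair of profiles that occurs: the
    meet of all [x_i] lies below each join of two of them, and dually for [y]. *)
Lemma profile_bounds n (x y : quad (antichain n))
    (a b12 b13 b14 b23 b24 b34 e d12 d13 d14 d23 d24 d34 : antichain n) :
  lower_profile x = (a, b12, b13, b14, b23, b24, b34) ->
  upper_profile y = (e, d12, d13, d14, d23, d24, d34) ->
  (a <= b12 `&` b13 `&` b14 `&` b23 `&` b24 `&` b34)%O &&
  (e >= d12 `|` d13 `|` d14 `|` d23 `|` d24 `|` d34)%O.
Proof.
case: x y => [[[x1 x2] x3] x4] [[[y1 y2] y3] y4].
case=> <- <- <- <- <- <- <- [<- <- <- <- <- <- <-]; rewrite !lexI !leUx.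
have [] : [/\ x1 `&` x2 `&` x3 `&` x4 <= x1, x1 `&` x2 `&` x3 `&` x4 <= x2
            & x1 `&` x2 `&` x3 `&` x4 <= x3]%O.
  by split; [rewrite -!meetA leIl | rewrite -2!meetA leIxr ?leIl |
             rewrite leIxl ?leIr].
move=> lx1 lx2 lx3.
have [] : [/\ y1 <= y1 `|` y2 `|` y3 `|` y4, y2 <= y1 `|` y2 `|` y3 `|` y4
            & y3 <= y1 `|` y2 `|` y3 `|` y4]%O.
  by split; [rewrite -!joinA leUl | rewrite -2!joinA lexUr ?leUl |
             rewrite lexUl ?leUr].
move=> ly1 ly2 ly3.
apply/andP; split; first by rewrite !lexU2 ?lx1 ?lx2 ?lx3.
by rewrite !leIx2 ?ly1 ?ly2 ?ly3.
Qed.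

(* The arguments delta_ij of the second P4 are listed by complementary pairs:
   a map f from the subsets of {1,2,3,4} to the antichains over 'I_n has
   beta_ij = f ({1,2,3,4} \ i) `|` f ({1,2,3,4} \ j), a lower bound of f at the
   complement of {i, j}, so the upper bound delta_ij of that same value is
   f {k} `&` f {l} for {k, l} the complement of {i, j}.  With the order
   delta12, ..., delta34 in both places the sum is 164 instead of 168 for
   n = 0. *)
Theorem theorem11p1 (n : nat) :
  dedekind (n + 4) =
  \sum_(alpha : antichain n) \sum_(epsilon : antichain n)
  \sum_(beta12 : antichain n) \sum_(beta13 : antichain n)
  \sum_(beta14 : antichain n) \sum_(beta23 : antichain n)
  \sum_(beta24 : antichain n) \sum_(beta34 : antichain n)
  \sum_(delta12 : antichain n) \sum_(delta13 : antichain n)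
  \sum_(delta14 : antichain n) \sum_(delta23 : antichain n)
  \sum_(delta24 : antichain n)
  \sum_(delta34 : antichain n |
      [&& alpha <= beta12 `&` beta13 `&` beta14 `&` beta23 `&` beta24
                   `&` beta34,
          epsilon >= delta12 `|` delta13 `|` delta14 `|` delta23 `|` delta24
                     `|` delta34,
          beta12 <= delta12, beta13 <= delta13, beta14 <= delta14,
          beta23 <= delta23, beta24 <= delta24 & beta34 <= delta34]%O)
    P4 alpha beta12 beta13 beta14 beta23 beta24 beta34
    * P4 (dual epsilon) (dual delta34) (dual delta24) (dual delta23)
         (dual delta14) (dual delta13) (dual delta12)
    * #|interval \bot%O alpha|
    * #|interval beta12 delta12| * #|interval beta13 delta13|
    * #|interval beta14 delta14| * #|interval beta23 delta23|
    * #|interval beta24 delta24| * #|interval beta34 delta34|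
    * #|interval epsilon \top%O|.
Proof.
rewrite addnC dedekind_cube monotone_cubes sum_profiles -sum_septets.
apply: eq_bigr => a _; apply: eq_bigr => e _.
apply: eq_bigr => b12 _; apply: eq_bigr => b13 _; apply: eq_bigr => b14 _.
apply: eq_bigr => b23 _; apply: eq_bigr => b24 _; apply: eq_bigr => b34 _.
apply: eq_bigr => d12 _; apply: eq_bigr => d13 _; apply: eq_bigr => d14 _.
apply: eq_bigr => d23 _; apply: eq_bigr => d24 _.
rewrite [RHS]big_mkcond; apply: eq_bigr => d34 _.
rewrite P4_upper_profile P4_lower_profile /fillings !mulnA.
(* It remains to see that a nonzero term satisfies the side conditions. *)
case: ifPn => //; apply: contraNeq; rewrite !muln_eq0 !negb_or -!andbA.
case/and5P=> nx ny _ /interval_nonempty-> /and5P[].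
do 4 move=> /interval_nonempty->; case/andP=> /interval_nonempty-> _.
have [[x eq_x] [y eq_y]] := (fibre_nonempty nx, fibre_nonempty ny).
by have /andP[-> ->] := profile_bounds eq_x eq_y.
Qed.
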